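(* There is an absolute constant $K>0$ such that the following holds. Let $p,\varepsilon,\delta\in(0,1)$ and $t\ge K\log(1/\delta)/(p\varepsilon)^4$. Let $\mathbf{x}_1,\dots,\mathbf{x}_t\sim\mathcal{D}_p$ independently. Then with probability at least $1-\delta$, \[1-\varepsilon\le\mathrm{median}_{i\in[t]}\Big\{\frac{|\mathbf{x}_i|}{\mathrm{median}(|\mathcal{D}_p|)}\Big\}\le1+\varepsilon.\]
   Context: For $p\in(0,1)$, $\mathcal{D}_p$ is the (standard) $p$-stable distribution, i.e. the distribution of $\frac{\sin(p\boldsymbol\theta)}{\cos^{1/p}(\boldsymbol\theta)}\big(\frac{\cos(\boldsymbol\theta(1-p))}{\ln(1/\mathbf{r})}\big)^{(1-p)/p}$ with $\boldsymbol\theta$ uniform on $[-\pi/2,\pi/2]$ and $\mathbf{r}$ uniform on $[0,1]$ independent. $\mathrm{median}(|\mathcal{D}_p|)=\sup\{z\in\mathbb{R}:\Pr_{\mathbf{x}\sim\mathcal{D}_p}[|\mathbf{x}|\le z]\le1/2\}$. *)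

(* Defs.v *)
From HB Require Import structures.
From mathcomp Require Import all_boot all_order all_algebra.
From mathcomp Require Import all_classical all_reals all_analysis.
From mathcomp Require Import measurable_realfun.

Set Implicit Arguments.
Unset Strict Implicit.
Unset Printing Implicit Defensive.

Import Order.TTheory GRing.Theory Num.Theory.
Import numFieldNormedType.Exports.

Local Open Scope classical_set_scope.
Local Open Scope ring_scope.

(* Where the formula is not defined (cos theta = 0, r = 0, r = 1) division by
   zero and ln return junk values; for theta uniform on [-pi/2, pi/2] and r
   uniform on [0, 1] this happens with probability zero. *)
Definition stable_formula (R : realType) (p theta r : R) : R :=
  sin (p * theta) / cos theta `^ (1 / p) *
  (cos (theta * (1 - p)) / ln (1 / r)) `^ ((1 - p) / p).

Definition stable_map (R : realType) (p : R)
    (w : measurableTypeR R * measurableTypeR R) : R :=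
  stable_formula p w.1 w.2.

Lemma measurable_fun_inv (R : realType) : measurable_fun [set: R] (@GRing.inv R).
Proof.
have <- : [set~ (0 : R)] `|` [set (0 : R)] = [set: R] by rewrite setUC setUCr.
apply/measurable_funU => //; first exact: measurableC.
split; last by apply: measurable_fun_set1.
apply: open_continuous_measurable_fun.
  exact/closed_openC/accessible_closed_set1/hausdorff_accessible/Rhausdorff.
by move=> x; rewrite inE => /= /eqP x0; exact: inv_continuous.
Qed.

Lemma measurable_stable_map (R : realType) (p : R) :
  measurable_fun [set: measurableTypeR R * measurableTypeR R] (stable_map p).
Proof.
have mcos : measurable_fun [set: R] (@cos R).
  by apply: continuous_measurable_fun; exact: continuous_cos.
have msin : measurable_fun [set: R] (@sin R).
  by apply: continuous_measurable_fun; exact: continuous_sin.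
apply: measurable_funM; first apply: measurable_funM.
- by apply: measurableT_comp => //; exact: measurable_funM.
- apply: (measurableT_comp (@measurable_fun_inv R)).
  apply: (measurableT_comp (measurable_powR _)).
  exact: measurableT_comp.
- apply: (measurableT_comp (measurable_powR _)).
  apply: measurable_funM.
    by apply: measurableT_comp => //; exact: measurable_funM.
  apply: (measurableT_comp (@measurable_fun_inv R)).
  apply: (measurableT_comp (@measurable_ln R)).
  apply: measurable_funM => //.
  exact: (measurableT_comp (@measurable_fun_inv R)).
Qed.

HB.instance Definition _ (R : realType) (p : R) :=
  isMeasurableFun.Build _ _ (measurableTypeR R * measurableTypeR R)%type R
    (stable_map p) (measurable_stable_map p).

Lemma Npihalf_lt_pihalf (R : realType) : - (pi / 2) < pi / 2 :> R.
Proof. by rewrite gtrN// divr_gt0// pi_gt0. Qed.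

Definition stable_dist (R : realType) (p : R) : probability R R :=
  distribution (uniform_prob (Npihalf_lt_pihalf R) \x uniform_prob (@ltr01 R))%E
    (stable_map p : {mfun _ >-> R}).

Definition median (R : realType) (F : R -> \bar R) : R :=
  sup [set z : R | (F z <= (1 / 2)%:E)%E].

Definition median_abs (R : realType) (mu : probability R R) : R :=
  median (fun z => mu [set x | `|x| <= z]).

(* The same supremum for an index drawn uniformly from 'I_t: the middle order
   statistic when t is odd, the upper of the two middle ones when t is even. *)
Definition sample_median (R : realType) (t : nat) (y : 'I_t -> R) : R :=
  median (fun z => (#|[pred i | y i <= z]|%:R / t%:R)%:E).

Definition mutually_independent (d : measure_display) (T : measurableType d)
    (R : realType) (P : probability T R) (I : finType)
    (X : I -> {RV P >-> R}) :=
  forall (J : {set I}) (B : I -> set R), (forall i, measurable (B i)) ->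
    P [set w | forall i, i \in J -> B i (X i w)] =
    (\prod_(i in J) P (X i @^-1` B i))%E.

(* Equality of laws is tested on Borel sets only: a probability takes
   unspecified values on non-measurable sets. *)
Definition has_law (d : measure_display) (T : measurableType d)
    (R : realType) (P : probability T R) (X : {RV P >-> R})
    (mu : probability R R) :=
  forall B : set R, measurable B -> distribution P X B = mu B.

(* Main.v *)
Require Import Defs.
From mathcomp Require Import all_boot all_order all_algebra.
From mathcomp Require Import all_classical all_reals all_analysis.
From mathcomp Require Import measurable_realfun.
From mathcomp Require Import ring lra zify.

Set Implicit Arguments.
Unset Strict Implicit.
Unset Printing Implicit Defensive.

Import Order.TTheory GRing.Theory Num.Theory.
Import numFieldNormedType.Exports.

Local Open Scope classical_set_scope.
Local Open Scope ring_scope.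

(** Let m be the median of |X| for X ~ D_p. On the quadrant 0 < theta < pi/2,
    0 < r < 1 the function p * ln |X| is nondecreasing in theta and in r, and on
    a compact box its Lipschitz constant does not depend on p. The box
    pi/16 <= |theta| <= 7 pi/16, 1/10 <= r <= 9/10 has probability 3/5 > 1/2, so
    m is the value of |X| at some point of it. Just below and just above that
    point lie rectangles with sides of order p * eps on which |X| stays between
    (1 - eps) m and m, resp. between m and (1 + eps) m, hence
    P(|X| < (1 - eps) m) <= 1/2 - eta and P(|X| <= (1 + eps) m) >= 1/2 + eta
    with eta of order (p * eps)^2.

    The sample median misses the interval only if more than half of the samples
    lie below it, or at most half lie at or below its right end. If
    a <= 1/2 - eta and 2k >= n then a^k (1 - a)^(n - k) <= (a (1 - a))^(n/2),
    which is at most 2^-n exp(-2 n eta^2). So each of the 2^n possible sets of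
    samples on one side contributes at most that much to the probability of
    failure, which is at most exp(-2 n eta^2). There is no constant factor in
    front, so the bound 1 - delta is reached for every delta < 1 and not only
    for small ones. *)

(** * Medians *)

Section median.
Context (R : realType) (F : R -> \bar R) (lo hi : R).
Hypothesis F_nondecreasing : {homo F : y z / (y <= z)%R >-> (y <= z)%E}.
Hypothesis F_lo : (F lo <= (1 / 2)%:E)%E.
Hypothesis F_hi : ((1 / 2)%:E < F hi)%E.

Let median_has_sup : has_sup [set z | (F z <= (1 / 2)%:E)%E].
Proof.
split; first by exists lo.
exists hi => z /= Fz; rewrite leNgt; apply/negP => /ltW/F_nondecreasing.
by move=> /(lt_le_trans F_hi); rewrite ltNge Fz.
Qed.

Lemma le_medianP a :
  a <= median F <-> (forall z, z < a -> (F z <= (1 / 2)%:E)%E).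
Proof.
split=> [am z za|F_below].
  have [y Fy zy] := sup_gt median_has_sup.1 (lt_le_trans za am).
  exact: le_trans (F_nondecreasing (ltW zy)) Fy.
rewrite leNgt; apply/negP => /midf_lt[lt_mid /F_below F_mid].
by have := sup_upper_bound median_has_sup F_mid; rewrite leNgt lt_mid.
Qed.

Lemma median_leP b :
  median F <= b <-> (forall z, b < z -> ((1 / 2)%:E < F z)%E).
Proof.
split=> [mb z|F_above].
  apply: contraTT; rewrite -!leNgt => Fz.
  exact: le_trans (sup_upper_bound median_has_sup Fz) mb.
apply: ge_sup => [|z /= Fz]; first exact: median_has_sup.1.
by rewrite leNgt; apply/negP => /F_above; rewrite ltNge Fz.
Qed.

End median.

Lemma leq_card_double (I : finType) (A B : {pred I}) :
  {subset A <= B} -> (#|A|.*2 <= #|B|.*2)%N.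
Proof.
by move=> AB; rewrite leq_double; exact/subset_leq_card/fintype.subsetP.
Qed.

Section sample_median.
Context (R : realType) (t : nat) (y : 'I_t -> R).
Hypothesis t_gt0 : (0 < t)%N.

Definition sample_cdf (z : R) : \bar R :=
  (#|[pred i | y i <= z]|%:R / t%:R)%:E.

Lemma sample_cdf_le_half z :
  (sample_cdf z <= (1 / 2)%:E)%E = (#|[pred i | (y i <= z)%R]|.*2 <= t)%N.
Proof.
rewrite lee_fin ler_pdivrMr ?ltr0n// mulrAC ler_pdivlMr// mul1r.
by rewrite -natrM muln2 ler_nat.
Qed.

Lemma sample_cdf_gt_half z :
  ((1 / 2)%:E < sample_cdf z)%E = (t < #|[pred i | (y i <= z)%R]|.*2)%N.
Proof. by rewrite ltNge sample_cdf_le_half ltnNge. Qed.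

Lemma sample_cdf_nondecreasing :
  {homo sample_cdf : u z / (u <= z)%R >-> (u <= z)%E}.
Proof.
move=> u z uz; rewrite lee_fin ler_wpM2r ?invr_ge0 ?ler0n// ler_nat.
by rewrite -leq_double leq_card_double// => i; rewrite !inE => /le_trans; apply.
Qed.

Lemma exists_sample_cdf_le_half : exists z, (sample_cdf z <= (1 / 2)%:E)%E.
Proof.
exists (\big[Num.min/0]_i y i - 1); rewrite sample_cdf_le_half eq_card0// => i.
rewrite !inE; apply/negbTE; rewrite -ltNge ltrBlDr.
by rewrite (@le_lt_trans _ _ (y i)) ?bigmin_le_cond// ltrDl.
Qed.

Lemma exists_sample_cdf_gt_half : exists z, ((1 / 2)%:E < sample_cdf z)%E.
Proof.
exists (\big[Num.max/0]_i y i); rewrite sample_cdf_gt_half eq_cardT.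
  by rewrite size_enum_ord; lia.
by move=> i; rewrite !inE; exact: le_bigmax_cond.
Qed.

Lemma le_sample_median a :
  (a <= sample_median y) = (#|[pred i | (y i < a)%R]|.*2 <= t)%N.
Proof.
have [lo F_lo] := exists_sample_cdf_le_half.
have [hi F_hi] := exists_sample_cdf_gt_half.
have medianP := le_medianP sample_cdf_nondecreasing F_lo F_hi a.
apply/idP/idP => [/medianP F_below|card_below].
  pose z := \big[Num.max/a - 1]_(i | y i < a) y i.
  have z_lt : z < a by apply/bigmax_ltP; split=> //; rewrite ltrBlDr ltrDl.
  have := F_below z z_lt; rewrite sample_cdf_le_half; apply: leq_trans.
  by rewrite leq_card_double// => i; rewrite !inE => ya; exact: le_bigmax_cond.
apply/medianP => z za; rewrite sample_cdf_le_half (leq_trans _ card_below)//.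
by rewrite leq_card_double// => i; rewrite !inE => /le_lt_trans; apply.
Qed.

Lemma sample_median_le b :
  (sample_median y <= b) = (t < #|[pred i | (y i <= b)%R]|.*2)%N.
Proof.
have [lo F_lo] := exists_sample_cdf_le_half.
have [hi F_hi] := exists_sample_cdf_gt_half.
have medianP := median_leP sample_cdf_nondecreasing F_lo F_hi b.
apply/idP/idP => [/medianP F_above|card_above].
  pose w := \big[Num.min/b + 1]_(i | b < y i) y i.
  have w_gt : b < w by apply/bigmin_gtP; split=> //; rewrite ltrDl.
  have [b_mid mid_w] := midf_lt w_gt.
  have := F_above _ b_mid; rewrite sample_cdf_gt_half => /leq_trans; apply.
  rewrite leq_card_double// => i; rewrite !inE => y_mid.
  rewrite leNgt; apply/negP => b_y.
  have w_le : w <= y i by exact: bigmin_le_cond.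
  by have := le_lt_trans y_mid (lt_le_trans mid_w w_le); rewrite ltxx.
apply/medianP => z bz; rewrite sample_cdf_gt_half (leq_trans card_above)//.
by rewrite leq_card_double// => i; rewrite !inE => /le_trans; apply; exact: ltW.
Qed.

End sample_median.

(** * Concentration of the sample median *)

Section hits.
Context d (T : measurableType d) (R : realType) (P : probability T R).
Context (I : finType) (X : I -> {RV P >-> R}) (B : set R).

Definition hits (w : T) : {set I} := [set i | X i w \in B]%SET.

Let cell (A : {set I}) (i : I) : set R := if i \in A then B else ~` B.

Let hits_fiberE (A : {set I}) : [set w | hits w = A] =
  [set w | forall i, i \in [set: I]%SET -> cell A i (X i w)].
Proof.
apply/seteqP; split=> w /=.
  move=> <- i _; rewrite /cell inE; case: ifPn => [/set_mem//|/negP notB Bw].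
  exact/notB/mem_set.
move=> in_cell; apply/setP => i; have := in_cell i (finset.in_setT i).
by rewrite inE /cell; case: ifP => _; [exact: mem_set|exact: memNset].
Qed.

Hypothesis B_measurable : measurable B.

Let cell_measurable (A : {set I}) i : measurable (cell A i).
Proof. by rewrite /cell; case: ifP => // _; exact: measurableC. Qed.

Let hits_fiber_measurable (A : {set I}) : measurable [set w | hits w = A].
Proof.
rewrite hits_fiberE.
have -> : [set w | forall i, i \in [set: I]%SET -> cell A i (X i w)] =
    \bigcap_(i in [set: I]) (X i @^-1` cell A i).
  by apply/seteqP; split=> w in_cell i _; exact: in_cell.
apply: fin_bigcap_measurable => [|i _]; first exact: finite_finset.
exact: measurable_funPTI.
Qed.

Let hits_preimageE (Q : pred {set I}) : [set w | Q (hits w)] =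
  \bigcup_(A in [set` [seq A <- index_enum {set I} | Q A]])
    [set w | hits w = A].
Proof.
apply/seteqP; split=> w /= => [Qw|[A]].
  by exists (hits w) => //=; rewrite mem_filter Qw mem_index_enum.
by rewrite /= mem_filter => /andP[QA _] ->.
Qed.

Lemma measurable_hits (Q : pred {set I}) : measurable [set w | Q (hits w)].
Proof.
rewrite hits_preimageE.
by apply: fin_bigcup_measurable => [|A _]; [exact: finite_seq|].
Qed.

Context (a : R).
Hypothesis X_indep : mutually_independent X.
Hypothesis prob_B : forall i, P (X i @^-1` B) = a%:E.

Lemma probability_hits_eq (A : {set I}) :
  P [set w | hits w = A] = (a ^+ #|A| * (1 - a) ^+ (#|I| - #|A|))%:E.
Proof.
rewrite hits_fiberE (X_indep _ (cell_measurable A)).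
have prob_cell i : P (X i @^-1` cell A i) = (if i \in A then a else 1 - a)%:E.
  rewrite /cell; case: ifP => _; first exact: prob_B.
  by rewrite preimage_setC probability_setC ?prob_B//; exact: measurable_funPTI.
rewrite (eq_bigr _ (fun i _ => prob_cell i)) prodEFin big_if /=.
rewrite (eq_bigl (mem A)) => [|i]; last by rewrite finset.in_setT.
rewrite prodr_const [X in _ * X](eq_bigl (mem (~: A))) => [|i].
  by rewrite prodr_const -(cardsC A) addKn.
by rewrite /= !inE.
Qed.

Lemma probability_hits (Q : pred {set I}) :
  P [set w | Q (hits w)] =
  (\sum_(A | Q A) a ^+ #|A| * (1 - a) ^+ (#|I| - #|A|))%:E.
Proof.
rewrite hits_preimageE measure_fin_bigcup//; last first.
  by move=> A1 A2 _ _ [w [<- <-]].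
rewrite -fsbig_seq ?filter_uniq ?index_enum_uniq//= big_filter.
by rewrite -sumEFin; apply: eq_bigr => A _; exact: probability_hits_eq.
Qed.

End hits.

Lemma mul_exprn_le_unbalanced (R : realDomainType) (x y s : R) (k j : nat) :
  0 <= x <= y -> 0 <= s -> x * y <= s ^+ 2 -> (j <= k)%N ->
  x ^+ k * y ^+ j <= s ^+ (k + j).
Proof.
move=> /andP[x0 xy] s0 xy_s jk; have y0 := le_trans x0 xy.
have x_le_s : x <= s.
  by rewrite -(@ler_pXn2r _ 2%N)// (le_trans _ xy_s)// expr2 ler_wpM2l.
rewrite -{1}(subnK jk) exprD -mulrA -exprMn.
have -> : (k + j = k - j + 2 * j)%N by lia.
rewrite exprD [s ^+ (2 * j)]exprM.
apply: ler_pM; rewrite ?exprn_ge0 ?mulr_ge0//.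
  by apply: lerXn2r; rewrite ?nnegrE.
by apply: lerXn2r; rewrite ?nnegrE ?mulr_ge0 ?exprn_ge0.
Qed.

Lemma mul_exprn_onem_le_expR (R : realType) (a eta : R) (k j : nat) :
  0 <= a <= 1 / 2 - eta -> 0 <= eta -> (j <= k)%N ->
  a ^+ k * (1 - a) ^+ j <= (expR (- (2 * eta ^+ 2)) / 2) ^+ (k + j).
Proof.
move=> /andP[a0 a_le] eta0 jk; apply: mul_exprn_le_unbalanced => //.
  by apply/andP; split; lra.
have e_sqr : 1 - 4 * eta ^+ 2 <= expR (- (2 * eta ^+ 2)) ^+ 2.
  by rewrite -expRM_natl (le_trans _ (expR_ge1Dx _))//; lra.
have gap_sqr : eta ^+ 2 <= (1 / 2 - a) ^+ 2 by rewrite lerXn2r ?nnegrE//; lra.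
by rewrite expr_div_n; lra.
Qed.

(* Every subset [A] occurs in exactly one of the two sums, and its term is at
   most [(expR (- 2 eta ^ 2) / 2) ^ #|I|]. *)
Lemma sum_majority_error_le (R : realType) (I : finType) (a b eta : R) :
  0 <= eta -> 0 <= a <= 1 / 2 - eta -> 1 / 2 + eta <= b <= 1 ->
  \sum_(A : {set I} | (#|I| < #|A|.*2)%N)
    a ^+ #|A| * (1 - a) ^+ (#|I| - #|A|) +
  \sum_(A : {set I} | (#|A|.*2 <= #|I|)%N)
    b ^+ #|A| * (1 - b) ^+ (#|I| - #|A|) <=
  expR (- (2 * (#|I|%:R * eta ^+ 2))).
Proof.
move=> eta0 a_bnd /andP[b_ge b_le1]; pose s := expR (- (2 * eta ^+ 2)) / 2.
have total :
    \sum_(A : {set I}) s ^+ #|I| = expR (- (2 * (#|I|%:R * eta ^+ 2))).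
  have card_subsets : #|{set I}| = (2 ^ #|I|)%N.
    by rewrite -[LHS]cardsT -finset.powersetT card_powerset cardsT.
  rewrite sumr_const card_subsets -[LHS]mulr_natl natrX.
  by rewrite -exprMn mulrC divfK// -expRM_natl; congr expR; ring.
rewrite -total [leRHS](bigID (fun A : {set I} => #|I| < #|A|.*2)%N) /=.
apply: lerD; [|under [leRHS]eq_bigl do rewrite -leqNgt];
    apply: ler_sum => A A_size; have A_card := max_card (mem A).
  by rewrite -[in leRHS](subnKC A_card) mul_exprn_onem_le_expR//; lia.
rewrite mulrC -[in X in _ * X](subKr 1 b) -[in leRHS](subnK A_card).
by rewrite mul_exprn_onem_le_expR//; [apply/andP; split; lra|lia].
Qed.

Lemma measurable_sublevel d (T : measurableType d) (R : realType)
    (g : T -> R) z :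
  measurable_fun [set: T] g -> measurable [set x | g x <= z].
Proof.
by move=> mg; rewrite -[X in measurable X]setTI; exact: measurable_fun_le.
Qed.

Lemma measurable_strict_sublevel d (T : measurableType d) (R : realType)
    (g : T -> R) z :
  measurable_fun [set: T] g -> measurable [set x | g x < z].
Proof.
move=> mg; have -> : [set x | g x < z] = ~` [set x | z <= g x].
  by apply/seteqP; split=> x /=; rewrite ltNge => /negP.
apply: measurableC; rewrite -[X in measurable X]setTI.
exact: measurable_fun_le.
Qed.

Lemma card_hits d (T : measurableType d) (R : realType) (P : probability T R)
    (I : finType) (X : I -> {RV P >-> R}) (q : pred R) w :
  #|hits X [set x | q x] w| = #|[pred i | q (X i w)]|.
Proof.
by rewrite cardsE; apply: eq_card => i; rewrite !inE; exact: asboolb.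
Qed.

Lemma sample_median_itvE d (T : measurableType d) (R : realType)
    (P : probability T R) (t : nat) (X : 'I_t -> {RV P >-> R})
    (g : R -> R) (a b : R) :
  (0 < t)%N ->
  [set w | a <= sample_median (fun i => g (X i w)) <= b] =
  ~` ([set w | (t < #|hits X [set x | (g x < a)%R] w|.*2)%N] `|`
      [set w | (#|hits X [set x | (g x <= b)%R] w|.*2 <= t)%N]).
Proof.
move=> t_gt0; apply/seteqP; split=> w /=;
  rewrite le_sample_median// sample_median_le// !card_hits.
  move=> /andP[a_le le_b] [|]; first by rewrite ltnNge a_le.
  by rewrite leqNgt le_b.
move=> /not_orP[/negP a_le /negP le_b].
by rewrite leqNgt a_le ltnNge.
Qed.

Lemma sample_median_concentration d (T : measurableType d) (R : realType)
    (P : probability T R) (t : nat) (X : 'I_t -> {RV P >-> R})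
    (mu : probability R R) (g : R -> R) (a b eta : R) :
  (forall i, has_law (X i) mu) -> mutually_independent X ->
  measurable_fun [set: R] g -> 0 <= eta ->
  (mu [set x | (g x < a)%R] <= (1 / 2 - eta)%:E)%E ->
  ((1 / 2 + eta)%:E <= mu [set x | (g x <= b)%R])%E ->
  ((1 - expR (- (2 * (t%:R * eta ^+ 2))))%:E <=
    P [set w | (a <= sample_median (fun i => g (X i w)) <= b)%R])%E.
Proof.
move=> X_law X_indep mg eta0 mu_lt mu_le.
have [t0|t_gt0] := posnP t.
  by rewrite [t%:R](_ : _ = 0) ?t0// mul0r mulr0 oppr0 expR0 subrr.
set below := [set x | g x < a] in mu_lt.
set upto := [set x | g x <= b] in mu_le.
have m_below : measurable below := measurable_strict_sublevel a mg.
have m_upto : measurable upto := measurable_sublevel b mg.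
have prob_preimage (B : set R) :
    measurable B -> forall i, P (X i @^-1` B) = (fine (mu B))%:E.
  by move=> mB i; rewrite fineK ?fin_num_measure//; exact: X_law.
have fine_below : 0 <= fine (mu below) <= 1 / 2 - eta.
  by rewrite fine_ge0//= -lee_fin fineK ?fin_num_measure.
have fine_upto : 1 / 2 + eta <= fine (mu upto) <= 1.
  by rewrite -!lee_fin fineK ?fin_num_measure// mu_le probability_le1.
pose majority (A : {set 'I_t}) := (t < #|A|.*2)%N.
pose minority (A : {set 'I_t}) := (#|A|.*2 <= t)%N.
have m_major := measurable_hits X m_below majority.
have m_minor := measurable_hits X m_upto minority.
rewrite sample_median_itvE// probability_setC; last exact: measurableU.
rewrite EFinB leeB//; apply: le_trans (measureU2 P m_major m_minor) _.
rewrite [X in (X + _)%E](probability_hits m_below X_indep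
  (prob_preimage _ m_below)).
rewrite [X in (_ + X)%E](probability_hits m_upto X_indep
  (prob_preimage _ m_upto)).
have := sum_majority_error_le 'I_t eta0 fine_below fine_upto.
by rewrite lee_fin card_ord.
Qed.

(** * Trigonometric and logarithmic inequalities *)

Section trigo_ln_inequalities.
Context (R : realType).
Implicit Types x y q r s : R.

Lemma ler_cos_0pi x y : 0 <= x -> x <= y -> y <= pi -> cos y <= cos x.
Proof.
move=> x0; rewrite le_eqVlt => /predU1P[->//|xy] ypi.
by apply/ltW; rewrite ltr_cos// in_itv /=; lra.
Qed.

Lemma ler_sin_pihalf x y :
  - (pi / 2) <= x -> x <= y -> y <= pi / 2 -> sin x <= sin y.
Proof.
move=> x0; rewrite le_eqVlt => /predU1P[->//|xy] ypi.
by apply/ltW; rewrite ltr_sin// in_itv /=; lra.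
Qed.

Lemma sin_sub_le x y : x <= y -> sin y - sin x <= y - x.
Proof.
move=> xy; have [//||z _ ->] := @MVT_segment R sin cos x y.
  by apply: continuous_subspaceT => z; exact: continuous_sin.
by rewrite ler_piMl ?subr_ge0// cos_le1.
Qed.

Lemma cos_sub_le x y : x <= y -> cos x - cos y <= y - x.
Proof.
move=> xy; have := @sin_sub_le (x - pi / 2) (y - pi / 2).
by rewrite !sinBpihalf; lra.
Qed.

Lemma mul_cos_le_sin x : 0 <= x <= pi -> x * cos x <= sin x.
Proof.
move=> /andP[x0 xpi]; have [//||z] := @MVT_segment R sin cos 0 x.
  by apply: continuous_subspaceT => z; exact: continuous_sin.
rewrite in_itv /= => /andP[z0 zx]; rewrite sin0 !subr0 => ->.
by rewrite mulrC ler_wpM2r// ler_cos_0pi.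
Qed.

(* Product-to-sum formulas reduce the claim to the monotonicity of [cos]. *)
Lemma cos_scale_cross_le q x y :
  0 <= q <= 1 -> 0 <= x -> x <= y -> y <= pi / 2 ->
  cos (x * q) * cos y <= cos (y * q) * cos x.
Proof.
move=> /andP[q0 q1] x0 xy ypi.
have sum_le : cos (y + x * q) <= cos (x + y * q) by apply: ler_cos_0pi; nra.
have diff_le : cos (y - x * q) <= cos (x - y * q).
  rewrite -[cos (x - _)]cos_norm; apply: ler_cos_0pi => //; last nra.
  by rewrite ler_norml; apply/andP; split; nra.
by rewrite !cosD in sum_le; rewrite !cosB in diff_le; lra.
Qed.

Lemma ln_sub_le x y : 0 < x -> 0 < y -> ln y - ln x <= (y - x) / x.
Proof.
move=> x0 y0; rewrite -ln_div ?posrE//.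
have -> : y / x = 1 + (y - x) / x by field; rewrite gt_eqF.
by apply: le_ln1Dx; rewrite ltr_pdivlMr//; lra.
Qed.

Lemma oppr_ln_gt0 r : 0 < r < 1 -> 0 < - ln r.
Proof. by move=> r01; rewrite oppr_gt0 ln_lt0. Qed.

Lemma ltr_ln_oppr_ln r s :
  0 < r -> r < s -> s < 1 -> ln (- ln s) < ln (- ln r).
Proof.
move=> r0 rs s1.
rewrite ltr_ln ?posrE ?oppr_ln_gt0 ?ltrN2 ?ltr_ln ?posrE//; lra.
Qed.

Lemma ler_ln_oppr_ln r s :
  0 < r -> r <= s -> s < 1 -> ln (- ln s) <= ln (- ln r).
Proof.
move=> r0; rewrite le_eqVlt => /predU1P[->//|rs] s1.
by rewrite ltW// ltr_ln_oppr_ln.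
Qed.

Lemma ln_oppr_ln_sub_le r s : 0 < r -> r <= s -> s < 1 ->
  ln (- ln r) - ln (- ln s) <= (s - r) / (r * (1 - s)).
Proof.
move=> r0 rs s1; have lns : 0 < - ln s by rewrite oppr_ln_gt0//; lra.
have lnr : 0 < - ln r by rewrite oppr_ln_gt0//; lra.
apply: le_trans (ln_sub_le lns lnr) _.
have num_le : - ln r - - ln s <= (s - r) / r.
  by have := @ln_sub_le r s r0; lra.
have den_ge : 1 - s <= - ln s.
  by have := @le_ln1Dx R (s - 1); rewrite subrKC; lra.
rewrite invfM mulrA ler_pM ?invr_ge0 ?lef_pV2 ?posrE ?(ltW lns)//; last lra.
by rewrite opprK addrC subr_ge0 ler_ln ?posrE//; lra.
Qed.

Lemma ln_cos_sub_le x y : 0 <= x -> x <= y -> y < pi / 2 ->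
  ln (cos x) - ln (cos y) <= (y - x) / cos y.
Proof.
move=> x0 xy ypi; have cosy : 0 < cos y by apply: cos_gt0_pihalf; lra.
have cosx : 0 < cos x by apply: cos_gt0_pihalf; lra.
apply: le_trans (ln_sub_le cosy cosx) _.
by rewrite ler_pM2r ?invr_gt0// cos_sub_le.
Qed.

Lemma ln_sin_sub_le x y : 0 < x -> x <= y -> y < pi / 2 ->
  ln (sin y) - ln (sin x) <= (y - x) / (x * cos y).
Proof.
move=> x0 xy ypi; have siny : 0 < sin y by apply: sin_gt0_pihalf; lra.
have sinx : 0 < sin x by apply: sin_gt0_pihalf; lra.
have cosy : 0 < cos y by apply: cos_gt0_pihalf; lra.
apply: le_trans (ln_sub_le sinx siny) _.
apply: ler_pM; rewrite ?sin_sub_le ?invr_ge0 ?(ltW sinx)//.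
  by rewrite subr_ge0 ler_sin_pihalf//; lra.
rewrite lef_pV2 ?posrE ?mulr_gt0//.
apply: le_trans (mul_cos_le_sin _); last lra.
by rewrite ler_pM2l// ler_cos_0pi//; lra.
Qed.

Lemma ln_sin_scale_sub_le q x y : 0 < q < 1 -> 0 < x -> x <= y -> y < pi / 2 ->
  q * (ln (sin (q * y)) - ln (sin (q * x))) <= (y - x) / (x * cos y).
Proof.
move=> /andP[q0 q1] x0 xy ypi; have qy_lt : q * y < pi / 2 by nra.
have qx0 : 0 < q * x by rewrite mulr_gt0.
have qxy : q * x <= q * y by rewrite ler_pM2l.
have cosy : 0 < cos y by apply: cos_gt0_pihalf; lra.
have cos_le : cos y <= cos (q * y) by apply: ler_cos_0pi; nra.
have diff_ge0 : 0 <= ln (sin (q * y)) - ln (sin (q * x)).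
  rewrite subr_ge0 ler_ln ?posrE ?ler_sin_pihalf ?sin_gt0_pihalf//; lra.
apply: le_trans (ler_piMl diff_ge0 (ltW q1)) _.
apply: le_trans (ln_sin_sub_le qx0 qxy qy_lt) _.
have cosqy := lt_le_trans cosy cos_le.
have -> : (q * y - q * x) / (q * x * cos (q * y)) = (y - x) / (x * cos (q * y)).
  by field; rewrite !gt_eqF.
by rewrite ler_wpM2l ?subr_ge0// lef_pV2 ?posrE ?mulr_gt0// ler_pM2l.
Qed.

Lemma ln_cos_scale_sub_le q x y :
  0 <= q <= 1 -> 0 <= x -> x <= y -> y < pi / 2 ->
  q * (ln (cos (x * q)) - ln (cos (y * q))) <= ln (cos x) - ln (cos y).
Proof.
move=> q01 x0 xy ypi; have /andP[q0 q1] := q01.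
have cos_gt0 z : 0 <= z < pi / 2 -> 0 < cos z.
  by move=> zpi; apply: cos_gt0_pihalf; lra.
have cos_scale_gt0 z : 0 <= z < pi / 2 -> 0 < cos (z * q).
  by move=> /andP[z0 zpi]; apply: cos_gt0; apply/andP; split; nra.
have scale_le : ln (cos (y * q)) <= ln (cos (x * q)).
  by rewrite ler_ln ?posrE ?cos_scale_gt0 ?ler_cos_0pi//; nra.
apply: (@le_trans _ _ (ln (cos (x * q)) - ln (cos (y * q)))).
  by rewrite ler_piMl// subr_ge0.
have := cos_scale_cross_le q01 x0 xy (ltW ypi).
rewrite -ler_ln ?posrE ?mulr_gt0 ?cos_scale_gt0 ?cos_gt0//; try lra.
by rewrite !lnM ?posrE ?cos_scale_gt0 ?cos_gt0//; lra.
Qed.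

End trigo_ln_inequalities.

(** * The stable formula on the positive quadrant *)

Definition stable_log (R : realType) (p theta r : R) : R :=
  p * ln (sin (p * theta)) - ln (cos theta)
  + (1 - p) * ln (cos (theta * (1 - p))) - (1 - p) * ln (- ln r).

Lemma stable_formulaN (R : realType) (p theta r : R) :
  stable_formula p (- theta) r = - stable_formula p theta r.
Proof. by rewrite /stable_formula mulrN sinN mulNr !cosN !mulNr cosN. Qed.

(* A Lipschitz constant of [stable_log p] on [pi/32, 15pi/32] x [1/20, 19/20],
   the same for every [p]. *)
Definition stable_lipschitz (R : realType) : R :=
  (pi / 32 * cos (15 * pi / 32))^-1 + (cos (15 * pi / 32))^-1 + 400.

Lemma stable_lipschitz_ge1 (R : realType) : 1 <= stable_lipschitz R.
Proof.
have pi0 := pi_gt0 R.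
have cos0 : 0 < cos (15 * pi / 32 : R) by apply: cos_gt0_pihalf; lra.
have := ltW cos0; rewrite -invr_ge0 => inv_cos0.
have : 0 <= (pi / 32 * cos (15 * pi / 32 : R))^-1.
  by rewrite invr_ge0 mulr_ge0 ?(ltW cos0)//; lra.
by rewrite /stable_lipschitz; lra.
Qed.

Section stable_formula.
Context (R : realType) (p : R).
Hypothesis p01 : 0 < p < 1.
Implicit Types a b theta r s : R.

Let sin_scale_gt0 theta : 0 < theta < pi / 2 -> 0 < sin (p * theta).
Proof.
move: p01 => /andP[p0 p1] /andP[theta0 theta_lt].
by apply: sin_gt0_pihalf; apply/andP; split; nra.
Qed.

Let cos_quadrant_gt0 theta : 0 < theta < pi / 2 -> 0 < cos theta.
Proof. by move=> theta_quad; apply: cos_gt0_pihalf; lra. Qed.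

Let cos_scale_gt0 theta : 0 < theta < pi / 2 -> 0 < cos (theta * (1 - p)).
Proof.
move: p01 => /andP[p0 p1] /andP[theta0 theta_lt].
by apply: cos_gt0_pihalf; apply/andP; split; nra.
Qed.

Lemma stable_formulaE theta r : 0 < theta < pi / 2 -> 0 < r < 1 ->
  stable_formula p theta r = expR (stable_log p theta r / p).
Proof.
move=> theta_quad r01; have /andP[p0 _] := p01; have /andP[r0 _] := r01.
rewrite /stable_formula (div1r r) lnV ?posrE//.
have ratio0 : 0 < cos (theta * (1 - p)) / - ln r.
  by rewrite divr_gt0 ?cos_scale_gt0 ?oppr_ln_gt0.
rewrite /powR !gt_eqF ?cos_quadrant_gt0//.
rewrite -{1}(lnK (x := sin _)) ?posrE ?sin_scale_gt0// -expRN -!expRD.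
rewrite ln_div ?posrE ?cos_scale_gt0 ?oppr_ln_gt0// /stable_log; congr expR.
by field; rewrite gt_eqF.
Qed.

Lemma stable_formula_gt0 theta r :
  0 < theta < pi / 2 -> 0 < r < 1 -> 0 < stable_formula p theta r.
Proof. by move=> theta_quad r01; rewrite stable_formulaE ?expR_gt0. Qed.

Lemma stable_log_le a b r s :
  0 < a -> a <= b -> b < pi / 2 -> 0 < r -> r <= s -> s < 1 ->
  stable_log p a r <= stable_log p b s.
Proof.
move=> a0 ab bpi r0 rs s1; have /andP[p0 p1] := p01.
have sin_le : p * ln (sin (p * a)) <= p * ln (sin (p * b)).
  rewrite ler_pM2l// ler_ln ?posrE ?sin_scale_gt0//; try lra.
  by apply: ler_sin_pihalf; nra.
have cos_le : (1 - p) * (ln (cos (a * (1 - p))) - ln (cos (b * (1 - p)))) <=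
    ln (cos a) - ln (cos b) by apply: ln_cos_scale_sub_le; lra.
have ln_le : (1 - p) * ln (- ln s) <= (1 - p) * ln (- ln r).
  by rewrite ler_pM2l ?subr_gt0 ?ler_ln_oppr_ln.
by rewrite /stable_log; lra.
Qed.

Lemma stable_formula_le a b r s :
  0 < a -> a <= b -> b < pi / 2 -> 0 < r -> r <= s -> s < 1 ->
  stable_formula p a r <= stable_formula p b s.
Proof.
move=> a0 ab bpi r0 rs s1; have /andP[p0 _] := p01.
rewrite !stable_formulaE; try lra.
by rewrite ler_expR ler_pM2r ?invr_gt0// stable_log_le.
Qed.

Lemma stable_formula_ltr theta r s :
  0 < theta < pi / 2 -> 0 < r -> r < s -> s < 1 ->
  stable_formula p theta r < stable_formula p theta s.
Proof.
move=> theta_quad r0 rs s1; have /andP[p0 p1] := p01.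
rewrite !stable_formulaE; try lra.
rewrite ltr_expR ltr_pM2r ?invr_gt0// /stable_log ler_ltD// ltrN2.
by rewrite ltr_pM2l ?subr_gt0 ?ltr_ln_oppr_ln.
Qed.

Lemma stable_log_sub_le a b r s :
  0 < a -> a <= b -> b < pi / 2 -> 0 < r -> r <= s -> s < 1 ->
  stable_log p b s - stable_log p a r <=
  (b - a) / (a * cos b) + (b - a) / cos b + (s - r) / (r * (1 - s)).
Proof.
move=> a0 ab bpi r0 rs s1; have /andP[p0 p1] := p01.
have sin_part := ln_sin_scale_sub_le p01 a0 ab bpi.
have cos_part := ln_cos_sub_le (ltW a0) ab bpi.
have scaled_cos_le : ln (cos (b * (1 - p))) <= ln (cos (a * (1 - p))).
  rewrite ler_ln ?posrE ?cos_scale_gt0//; try lra.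
  by apply: ler_cos_0pi; nra.
have ln_part : (1 - p) * (ln (- ln r) - ln (- ln s)) <= (s - r) / (r * (1 - s)).
  apply: le_trans (ln_oppr_ln_sub_le r0 rs s1).
  by rewrite ler_piMl ?subr_ge0 ?ler_ln_oppr_ln//; lra.
have : 0 <= (1 - p) * (ln (cos (a * (1 - p))) - ln (cos (b * (1 - p)))).
  by rewrite mulr_ge0 ?subr_ge0//; lra.
by rewrite /stable_log; lra.
Qed.

Lemma stable_log_continuous (theta r : R -> R) u :
  {for u, continuous theta} -> {for u, continuous r} ->
  0 < theta u < pi / 2 -> 0 < r u < 1 ->
  {for u, continuous (fun v => stable_log p (theta v) (r v))}.
Proof.
move=> theta_cont r_cont theta_quad r01; have /andP[r0 _] := r01.
apply: cvgB; [apply: cvgD; first apply: cvgB|].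
- apply: cvgMr.
  apply: (continuous_cvg _ (continuous_ln (sin_scale_gt0 theta_quad))).
  by apply: (continuous_cvg _ (@continuous_sin R _)); exact: cvgMr.
- apply: (continuous_cvg _ (continuous_ln (cos_quadrant_gt0 theta_quad))).
  exact: (continuous_cvg _ (@continuous_cos R _)).
- apply: cvgMr.
  apply: (continuous_cvg _ (continuous_ln (cos_scale_gt0 theta_quad))).
  by apply: (continuous_cvg _ (@continuous_cos R _)); exact: cvgMl.
- apply: cvgMr; apply: (continuous_cvg _ (continuous_ln (oppr_ln_gt0 r01))).
  by apply: cvgN; exact: (continuous_cvg _ (continuous_ln r0)).
Qed.

Lemma stable_formula_IVT a b r s v :
  0 < a -> a <= b -> b < pi / 2 -> 0 < r -> r <= s -> s < 1 ->
  stable_formula p a r <= v <= stable_formula p b s ->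
  exists theta rho, [/\ a <= theta <= b, r <= rho <= s &
    v = stable_formula p theta rho].
Proof.
move=> a0 ab bpi r0 rs s1 v_bnd.
pose theta u := a + u * (b - a); pose rho u := r + u * (s - r).
have line_continuous (c e u : R) : {for u, continuous (fun v : R => c + v * e)}.
  by apply: cvgD; [exact: cvg_cst|apply: cvgMl; exact: cvg_id].
have theta_itv u : 0 <= u <= 1 -> a <= theta u <= b.
  by move=> /andP[u0 u1]; apply/andP; split; rewrite /theta; nra.
have rho_itv u : 0 <= u <= 1 -> r <= rho u <= s.
  by move=> /andP[u0 u1]; apply/andP; split; rewrite /rho; nra.
pose f u := expR (stable_log p (theta u) (rho u) / p).
have fE u : 0 <= u <= 1 -> stable_formula p (theta u) (rho u) = f u.
  move=> u01; have := theta_itv u u01; have := rho_itv u u01.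
  by move=> rho_u theta_u; rewrite stable_formulaE//; lra.
have f_continuous : {within `[0, 1], continuous f}.
  apply: continuous_in_subspaceT => u; rewrite inE /= in_itv /= => u01.
  apply: (continuous_cvg _ (@continuous_expR R _)); apply: cvgMl.
  have := theta_itv u u01; have := rho_itv u u01 => rho_u theta_u.
  apply: stable_log_continuous; try lra; exact: line_continuous.
have f0 : f 0 = stable_formula p a r.
  by rewrite -fE ?lexx ?ler01// /theta /rho !mul0r !addr0.
have f1 : f 1 = stable_formula p b s.
  by rewrite -fE ?lexx ?ler01// /theta /rho !mul1r !subrKC.
have [|u] := IVT ler01 f_continuous (v := v).
  by case/andP: v_bnd => ge_v le_v; rewrite f0 f1 ge_min le_max ge_v le_v orbT.
rewrite in_itv /= => u01 fu; exists (theta u), (rho u).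
by split; [exact: theta_itv|exact: rho_itv|rewrite fE].
Qed.

Lemma stable_formula_lipschitz a b r s :
  pi / 32 <= a -> a <= b -> b <= 15 * pi / 32 ->
  1 / 20 <= r -> r <= s -> s <= 19 / 20 ->
  stable_formula p b s <=
  expR (stable_lipschitz R * (b - a + (s - r)) / p) * stable_formula p a r.
Proof.
move=> a_ge ab b_le r_ge rs s_le; have pi0 := pi_gt0 R.
have /andP[p0 _] := p01.
have cos0 : 0 < cos (15 * pi / 32 : R) by apply: cos_gt0_pihalf; lra.
have cosb : cos (15 * pi / 32) <= cos b by apply: ler_cos_0pi; lra.
rewrite !stable_formulaE; try lra.
rewrite -expRD -mulrDl ler_expR ler_pM2r ?invr_gt0// -lerBlDr.
apply: le_trans (stable_log_sub_le _ ab _ _ rs _) _; try lra.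
have sin_le : (a * cos b)^-1 <= (pi / 32 * cos (15 * pi / 32))^-1.
  by rewrite lef_pV2 ?posrE ?mulr_gt0 ?ler_pM//; lra.
have cos_le : (cos b)^-1 <= (cos (15 * pi / 32))^-1.
  by rewrite lef_pV2 ?posrE//; lra.
have ln_le : (r * (1 - s))^-1 <= 400.
  have r20 : r^-1 <= 20 by rewrite invf_ple ?posrE; lra.
  have s20 : (1 - s)^-1 <= 20 by rewrite invf_ple ?posrE; lra.
  rewrite invfM (_ : 400 = 20 * 20) ?ler_pM ?invr_ge0//; lra.
have inv_sin0 : 0 <= (pi / 32 * cos (15 * pi / 32 : R))^-1.
  by rewrite invr_ge0 mulr_ge0 ?(ltW cos0)//; lra.
have inv_cos0 : 0 <= (cos (15 * pi / 32 : R))^-1 by rewrite invr_ge0 ltW.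
have ba0 : 0 <= b - a by lra.
have sr0 : 0 <= s - r by lra.
have := ler_wpM2l ba0 sin_le; have := ler_wpM2l ba0 cos_le.
have := ler_wpM2l sr0 ln_le; rewrite /stable_lipschitz; nra.
Qed.

End stable_formula.

(** * Mass of the stable law around its median *)

Lemma uniform_prob_itv (R : realType) (a b c d : R) (ab : a < b) :
  a <= c -> c <= d -> d <= b ->
  uniform_prob ab `[c, d] = ((d - c) / (b - a))%:E.
Proof.
move=> ac cd db; rewrite /uniform_prob.
under eq_integral => x.
  rewrite inE /= in_itv /= => /andP[cx xd].
  rewrite /uniform_pdf (le_trans ac cx) (le_trans xd db) /=.
  over.
rewrite integral_cst//= lebesgue_measure_itv /= lte_fin.
case: ltP => [_|dc]; first by rewrite -EFinB -EFinM mulrC.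
by rewrite mule0 (_ : d - c = 0) ?mul0r//; lra.
Qed.

Lemma probability_disjoint_le d (T : measurableType d) (R : realType)
    (P : probability T R) (A B C : set T) :
  measurable A -> measurable B -> measurable C -> A `&` B = set0 ->
  A `<=` C -> B `<=` C -> (P A + P B <= P C)%E.
Proof.
move=> mA mB mC AB AC BC; rewrite -measureU//.
apply: le_measure; rewrite ?inE//; first exact: measurableU.
by rewrite subUset.
Qed.

Lemma stable_dist_ge_rectangle (R : realType) (p a b c d : R) (B : set R) :
  measurable B -> 0 < a -> a <= b -> b <= pi / 2 ->
  0 <= c -> c <= d -> d <= 1 ->
  (forall theta r, a <= theta <= b -> c <= r <= d ->
    B (stable_formula p theta r) /\ B (- stable_formula p theta r)) ->
  ((2 * ((b - a) / pi * (d - c)))%:E <= stable_dist p B)%E.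
Proof.
move=> mB a0 ab b_le c0 cd d_le B_rect.
pose mu := (uniform_prob (Npihalf_lt_pihalf R) \x uniform_prob (@ltr01 R))%E.
have mu_rectangle x y : - (pi / 2) <= x -> x <= y -> y <= pi / 2 ->
    mu (`[x, y] `*` `[c, d]) = ((y - x) / pi * (d - c))%:E.
  move=> x_ge xy y_le; rewrite /mu product_measure1E//= !uniform_prob_itv//.
  by rewrite -EFinM subr0 divr1 opprK -splitr.
have right_mass : mu (`[a, b] `*` `[c, d]) = ((b - a) / pi * (d - c))%:E.
  by apply: mu_rectangle; lra.
have left_mass : mu (`[- b, - a] `*` `[c, d]) = ((b - a) / pi * (d - c))%:E.
  by rewrite mu_rectangle; [congr (_ / _ * _)%:E; lra|lra..].
rewrite mulr_natl mulr2n EFinD -{1}right_mass -left_mass.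
apply: probability_disjoint_le.
- exact: measurableX.
- exact: measurableX.
- by rewrite -[X in measurable X]setTI; exact: measurable_stable_map.
- apply/seteqP; split=> // -[theta r] /= [[]].
  by rewrite !in_itv /= => theta_pos _ [theta_neg _]; lra.
- move=> [theta r] /= []; rewrite !in_itv /= => theta_itv r_itv.
  by case: (B_rect theta r).
- move=> [theta r] /= []; rewrite !in_itv /= => theta_itv r_itv.
  rewrite /preimage /= /stable_map /= -[theta]opprK stable_formulaN.
  by case: (B_rect (- theta) r) => //; lra.
Qed.

Definition normr_cdf (R : realType) (mu : probability R R) (z : R) : \bar R :=
  mu [set x | `|x| <= z].

Definition normr_cdf_left (R : realType) (mu : probability R R) (z : R) :
  \bar R :=
  mu [set x | `|x| < z].

Arguments normr_cdf {R} mu z%_R.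
Arguments normr_cdf_left {R} mu z%_R.

Section normr_cdf.
Context (R : realType) (mu : probability R R).
Implicit Types y z : R.

Lemma normr_cdf_nondecreasing :
  {homo normr_cdf mu : y z / (y <= z)%R >-> (y <= z)%E}.
Proof.
move=> y z yz; apply: le_measure; rewrite ?inE.
- exact: measurable_sublevel.
- exact: measurable_sublevel.
- by move=> x /= /le_trans; apply.
Qed.

Lemma normr_cdf_left_nondecreasing :
  {homo normr_cdf_left mu : y z / (y <= z)%R >-> (y <= z)%E}.
Proof.
move=> y z yz; apply: le_measure; rewrite ?inE.
- exact: measurable_strict_sublevel.
- exact: measurable_strict_sublevel.
- by move=> x /= /lt_le_trans; apply.
Qed.

Lemma normr_cdf_le_left y z :
  y < z -> (normr_cdf mu y <= normr_cdf_left mu z)%E.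
Proof.
move=> yz; apply: le_measure; rewrite ?inE.
- exact: measurable_sublevel.
- exact: measurable_strict_sublevel.
- by move=> x /= /le_lt_trans; apply.
Qed.

End normr_cdf.

Section stable_dist.
Context (R : realType) (p : R).
Hypothesis p01 : 0 < p < 1.
Implicit Types a b r s u v z : R.

Lemma stable_dist_shell_ge a b r s u v :
  0 < a -> a <= b -> b < pi / 2 -> 0 < r -> r <= s -> s < 1 ->
  u <= stable_formula p a r -> stable_formula p b s <= v ->
  (normr_cdf_left (stable_dist p) u + (2 * ((b - a) / pi * (s - r)))%:E <=
   normr_cdf (stable_dist p) v)%E.
Proof.
move=> a0 ab bpi r0 rs s1 u_le le_v.
have uv : u <= v.
  by apply: le_trans u_le (le_trans _ le_v); exact: stable_formula_le.
pose shell := [set x : R | `|x| <= v] `\` [set x | `|x| < u].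
have m_shell : measurable shell.
  apply: measurableD; first exact: measurable_sublevel.
  exact: measurable_strict_sublevel.
have shell_mass : ((2 * ((b - a) / pi * (s - r)))%:E <= stable_dist p shell)%E.
  apply: stable_dist_ge_rectangle; rewrite ?(ltW bpi) ?(ltW r0) ?(ltW s1)//.
  move=> theta rho theta_itv rho_itv; rewrite /shell /= normrN.
  rewrite gtr0_norm; last by apply: stable_formula_gt0 => //; lra.
  have ge_u : u <= stable_formula p theta rho.
    by apply: le_trans u_le _; apply: stable_formula_le => //; lra.
  have formula_le_v : stable_formula p theta rho <= v.
    by apply: le_trans le_v; apply: stable_formula_le => //; lra.
  by rewrite ltNge ge_u.
apply: le_trans (leeD2l _ shell_mass) _.
apply: probability_disjoint_le => //.
- exact: measurable_strict_sublevel.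
- exact: measurable_sublevel.
- by apply/seteqP; split=> // x [? []].
- by move=> x /= /ltW /le_trans; apply.
- by move=> x [].
Qed.

(* The values of [|X|] at the extreme corners of [pi/16, 7pi/16] x [1/10, 9/10];
   this box and its mirror image carry mass 3/5. *)
Let bottom : R := stable_formula p (pi / 16) (1 / 10).
Let top : R := stable_formula p (7 * pi / 16) (9 / 10).

Let box_mass u v : u <= bottom -> top <= v ->
  (normr_cdf_left (stable_dist p) u + (3 / 5)%:E <=
   normr_cdf (stable_dist p) v)%E.
Proof.
have pi0 := pi_gt0 R.
have -> : 3 / 5 = 2 * ((7 * pi / 16 - pi / 16) / pi * (9 / 10 - 1 / 10)) :> R.
  by move: (pi) pi0 => c c0; field; rewrite gt_eqF.
by apply: stable_dist_shell_ge => //; lra.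
Qed.

Let le_half_of_lt_bottom z : z < bottom ->
  (normr_cdf (stable_dist p) z <= (1 / 2)%:E)%E.
Proof.
move=> z_lt; apply: le_trans (normr_cdf_le_left _ z_lt) _.
have mass_le1 : (normr_cdf (stable_dist p) top <= 1)%E.
  by apply: probability_le1; exact: measurable_sublevel.
have := le_trans (box_mass (lexx bottom) (lexx top)) mass_le1.
by rewrite -leeBrDr// => /le_trans; apply; rewrite -EFinB lee_fin; lra.
Qed.

Let gt_half_of_ge_top z : top <= z ->
  ((1 / 2)%:E < normr_cdf (stable_dist p) z)%E.
Proof.
move=> z_ge; apply: lt_le_trans (box_mass (lexx bottom) z_ge).
apply: (@lt_le_trans _ _ (3 / 5)%:E); first by rewrite lte_fin; lra.
by rewrite leeDr.
Qed.

Let cdf_lo : (normr_cdf (stable_dist p) (bottom - 1) <= (1 / 2)%:E)%E.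
Proof. by apply: le_half_of_lt_bottom; rewrite ltrBlDr ltrDl. Qed.

Let cdf_hi : ((1 / 2)%:E < normr_cdf (stable_dist p) top)%E.
Proof. exact: gt_half_of_ge_top. Qed.

Lemma median_abs_stableE : exists theta r,
  [/\ pi / 16 <= theta <= 7 * pi / 16, 1 / 10 <= r <= 9 / 10 &
    median_abs (stable_dist p) = stable_formula p theta r].
Proof.
have pi0 := pi_gt0 R.
have bottom_le : bottom <= median_abs (stable_dist p).
  apply/(le_medianP (normr_cdf_nondecreasing _) cdf_lo cdf_hi).
  exact: le_half_of_lt_bottom.
have le_top : median_abs (stable_dist p) <= top.
  apply/(median_leP (normr_cdf_nondecreasing _) cdf_lo cdf_hi) => z /ltW.
  exact: gt_half_of_ge_top.
by apply: stable_formula_IVT => //; rewrite ?bottom_le ?le_top//; lra.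
Qed.

Lemma median_abs_stable_gt0 : 0 < median_abs (stable_dist p).
Proof.
have pi0 := pi_gt0 R.
have [theta [r [theta_box r_box ->]]] := median_abs_stableE.
by apply: stable_formula_gt0 => //; lra.
Qed.

Lemma normr_cdf_stable_le_half z : z < median_abs (stable_dist p) ->
  (normr_cdf (stable_dist p) z <= (1 / 2)%:E)%E.
Proof.
exact: (le_medianP (normr_cdf_nondecreasing _) cdf_lo cdf_hi _).1 (lexx _) z.
Qed.

Lemma normr_cdf_stable_gt_half z : median_abs (stable_dist p) < z ->
  ((1 / 2)%:E < normr_cdf (stable_dist p) z)%E.
Proof.
exact: (median_leP (normr_cdf_nondecreasing _) cdf_lo cdf_hi _).1 (lexx _) z.
Qed.

Section near_median.
Context (x : R).
Hypothesis x_small : 0 < x <= 1 / 40.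
Let ratio : R := expR (stable_lipschitz R * (x + x) / p).

Lemma stable_dist_below_median :
  (normr_cdf_left (stable_dist p) (ratio^-1 * median_abs (stable_dist p)) +
    (x ^+ 2 / pi)%:E <= (1 / 2)%:E)%E.
Proof.
have pi2 := pi_ge2 R; have /andP[x0 x_le] := x_small.
have [theta [r [theta_box r_box m_eq]]] := median_abs_stableE.
have lt_m : stable_formula p theta (r - x / 2) < median_abs (stable_dist p).
  by rewrite m_eq; apply: stable_formula_ltr => //; lra.
apply: le_trans (normr_cdf_stable_le_half lt_m).
have -> : x ^+ 2 / pi =
    2 * ((theta - (theta - x)) / pi * (r - x / 2 - (r - x))).
  by move: (pi^-1) => c; field.
apply: stable_dist_shell_ge => //; try lra.
have := @stable_formula_lipschitz R p p01 (theta - x) theta (r - x) r.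
by rewrite m_eq ler_pdivrMl ?expR_gt0// !subKr; apply; lra.
Qed.

Lemma stable_dist_above_median :
  ((1 / 2 + x ^+ 2 / pi)%:E <=
    normr_cdf (stable_dist p) (ratio * median_abs (stable_dist p)))%E.
Proof.
have pi2 := pi_ge2 R; have /andP[x0 x_le] := x_small.
have [theta [r [theta_box r_box m_eq]]] := median_abs_stableE.
have m_lt : median_abs (stable_dist p) < stable_formula p theta (r + x / 2).
  by rewrite m_eq; apply: stable_formula_ltr => //; lra.
have [m_mid mid_lt] := midf_lt m_lt.
have half_le := le_trans (ltW (normr_cdf_stable_gt_half m_mid))
  (normr_cdf_le_left _ mid_lt).
rewrite EFinD; apply: le_trans (leeD2r _ half_le) _.
have -> : x ^+ 2 / pi = 2 * ((theta + x - theta) / pi * (r + x - (r + x / 2))).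
  by move: (pi^-1) => c; field.
apply: stable_dist_shell_ge => //; try lra.
have := @stable_formula_lipschitz R p p01 theta (theta + x) r (r + x).
by rewrite m_eq ![_ + x - _]addrAC !subrr !add0r; apply; lra.
Qed.

End near_median.

End stable_dist.

Lemma expR_half_le1Dx (R : realType) (x : R) :
  0 <= x <= 1 -> expR (x / 2) <= 1 + x.
Proof.
move=> x01; have := expR_ge1Dx (- (x / 2)); rewrite expRN => inv_ge.
rewrite -[leLHS]invrK invf_ple ?posrE ?invr_gt0 ?expR_gt0//; last lra.
by apply: le_trans inv_ge; rewrite -div1r ler_pdivrMr; nra.
Qed.

Lemma stable_dist_near_median (R : realType) : exists2 c : R, 0 < c &
  forall p eps : R, 0 < p < 1 -> 0 < eps < 1 ->
  let m := median_abs (stable_dist p) in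
  (normr_cdf_left (stable_dist p) ((1 - eps) * m) <=
    (1 / 2 - c * (p * eps) ^+ 2)%:E)%E /\
  ((1 / 2 + c * (p * eps) ^+ 2)%:E <=
    normr_cdf (stable_dist p) ((1 + eps) * m))%E.
Proof.
pose L := stable_lipschitz R; have L_ge1 : 1 <= L := stable_lipschitz_ge1 R.
exists ((40 * L) ^- 2 / pi).
  by rewrite divr_gt0 ?invr_gt0 ?exprn_gt0 ?pi_gt0//; lra.
move=> p eps p01 eps01 m; have m0 : 0 < m := median_abs_stable_gt0 p01.
have /andP[p0 p1] := p01; have /andP[eps0 eps1] := eps01.
pose x := p * eps / (40 * L).
have x_small : 0 < x <= 1 / 40.
  rewrite divr_gt0 ?mulr_gt0//=; try lra.
  by rewrite ler_pdivrMr; nra.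
have -> : (40 * L) ^- 2 / pi * (p * eps) ^+ 2 = x ^+ 2 / pi.
  by rewrite expr_div_n mulrAC [_ * _ ^+ 2]mulrC.
have ratioE : L * (x + x) / p = eps / 20.
  by rewrite /x; field; rewrite !gt_eqF//; lra.
split.
  rewrite EFinB leeBrDr//.
  apply: le_trans (stable_dist_below_median p01 x_small).
  apply: leeD2r; apply: normr_cdf_left_nondecreasing.
  rewrite ler_pM2r// -expRN -/L ratioE.
  by apply: le_trans (expR_ge1Dx _); lra.
apply: le_trans (stable_dist_above_median p01 x_small) _.
apply: normr_cdf_nondecreasing; rewrite ler_pM2r// -/L ratioE.
apply: le_trans (expR_half_le1Dx _); last lra.
by rewrite ler_expR; lra.
Qed.

Lemma expR_sample_size_le (R : realType) (c x delta t : R) :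
  0 < c -> 0 < x -> 0 < delta < 1 ->
  c ^- 2 * ln (1 / delta) / x ^+ 4 <= t ->
  expR (- (2 * (t * (c * x ^+ 2) ^+ 2))) <= delta.
Proof.
move=> c0 x0 delta01 t_ge; have /andP[delta0 _] := delta01.
have eta2_gt0 : 0 < (c * x ^+ 2) ^+ 2 by rewrite exprn_gt0 ?mulr_gt0 ?exprn_gt0.
have {}t_ge : - ln delta <= t * (c * x ^+ 2) ^+ 2.
  rewrite -ler_pdivrMr//; move: t_ge; rewrite div1r lnV ?posrE//.
  by rewrite exprMn -exprM [_ * - _]mulrC -mulrA -invfM.
have ln_delta : ln delta < 0 by rewrite ln_lt0.
by rewrite -[leRHS]lnK ?posrE// ler_expR; lra.
Qed.

Theorem theorem9p6 (R : realType) :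
  exists K : R, 0 < K /\
    forall (p eps delta : R) (t : nat),
      0 < p < 1 -> 0 < eps < 1 -> 0 < delta < 1 ->
      K * ln (1 / delta) / (p * eps) ^+ 4 <= t%:R ->
      forall (d : measure_display) (T : measurableType d)
        (P : probability T R) (X : 'I_t -> {RV P >-> R}),
        (forall i, has_law (X i) (stable_dist p)) ->
        mutually_independent X ->
        ((1 - delta)%:E <=
          P [set w | (1 - eps <=
               sample_median
                 (fun i => `|X i w| / median_abs (stable_dist p)) <=
               1 + eps)%R])%E.
Proof.
have [c c0 near_median] := stable_dist_near_median R.
exists (c ^- 2); split; first by rewrite invr_gt0 exprn_gt0.
move=> p eps delta t p01 eps01 delta01 t_ge d T P X X_law X_indep.
have [below above] := near_median p eps p01 eps01.
have m0 := median_abs_stable_gt0 p01; set m := median_abs _ in below above m0 *.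
have pe0 : 0 < p * eps by rewrite mulr_gt0//; lra.
pose eta := c * (p * eps) ^+ 2.
have eta0 : 0 < eta by rewrite mulr_gt0 ?exprn_gt0.
have failure_le := expR_sample_size_le c0 pe0 delta01 t_ge.
apply: le_trans (sample_median_concentration (g := fun x => `|x| / m)
  (eta := eta) X_law X_indep _ _ _ _).
- by rewrite lee_fin lerB.
- by apply: measurable_funM => //; exact: measurableT_comp.
- exact: ltW.
- by under eq_set do rewrite ltr_pdivrMr//.
- by under eq_set do rewrite ler_pdivrMr//.
Qed.
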